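(* Let $R$ be a finite commutative ring with identity $1\neq 0$ such that $\Gamma(R)\neq\overline{\Gamma}(R)$. Then $\overline{\Gamma}(R)$ is complemented if and only if $R\cong B\times A_1\times\cdots\times A_n$ for some integer $n\geq 1$, where $B\cong \mathbb{Z}_4$ or $B\cong\mathbb{Z}_2[X]/(X^2)$, and $A_1,\dots,A_n$ are finite fields.
   Context: $Z(R)$ is the set of zero-divisors of $R$ (including $0$) and $Z(R)^*=Z(R)\setminus\{0\}$. $\mathbb{Z}_k=\mathbb{Z}/k\mathbb{Z}$. The zero-divisor graph $\Gamma(R)$ is the simple graph with vertex set $Z(R)^*$ in which two distinct vertices $x,y$ are adjacent if and only if $xy=0$. The extended zero-divisor graph $\overline{\Gamma}(R)$ is the simple graph with the same vertex set $Z(R)^*$ in which two distinct vertices $x,y$ are adjacent if and only if there exist positive integers $n,m$ with $x^ny^m=0$, $x^n\neq 0$ and $y^m\neq 0$. In a simple graph $G$, two vertices $u,v$ are orthogonal, written $u\perp v$, if they are adjacent and no vertex is adjacent to both of them. $G$ is complemented if for every vertex $v$ there is a vertex $u$ with $v\perp u$. *)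

(* Defs.v *)
From HB Require Import structures.
From mathcomp Require Import all_boot all_order all_algebra.

Set Implicit Arguments.
Unset Strict Implicit.
Unset Printing Implicit Defensive.

Import GRing.Theory.
Local Open Scope ring_scope.

Record sgraph (V : Type) := SGraph {
  adj : V -> V -> Prop;
  adj_sym : forall u v, adj u v -> adj v u;
  adj_irrefl : forall v, ~ adj v v
}.

(* Adjacency is Prop-valued, so equality of graphs on a common vertex set is
   stated as equality of edge sets rather than as Leibniz equality of records. *)
Definition same_graph (V : Type) (G H : sgraph V) : Prop :=
  forall u v, adj G u v <-> adj H u v.

Definition orthogonal (V : Type) (G : sgraph V) (u v : V) : Prop :=
  adj G u v /\ ~ (exists w, adj G w u /\ adj G w v).

Definition complemented (V : Type) (G : sgraph V) : Prop :=
  forall v, exists u, orthogonal G v u.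

Definition zero_divisors (R : finComNzRingType) : {set R} :=
  [set x | [exists y, (y != 0) && (x * y == 0)]].

Definition zd_vertex (R : finComNzRingType) : Type :=
  {x : R | x \in zero_divisors R :\ 0}.

Section Graphs.

Variable R : finComNzRingType.
Implicit Types x y : zd_vertex R.

Definition zd_adj x y : Prop := x <> y /\ val x * val y = 0.

Definition ext_zd_adj x y : Prop :=
  x <> y /\
  exists n m : nat,
    [/\ (0 < n)%N, (0 < m)%N, val x ^+ n * val y ^+ m = 0,
        val x ^+ n <> 0 & val y ^+ m <> 0].

Lemma zd_adj_sym x y : zd_adj x y -> zd_adj y x.
Proof. by case=> neq xy0; split; [exact: nesym | rewrite mulrC]. Qed.

Lemma zd_adj_irrefl x : ~ zd_adj x x.
Proof. by case. Qed.

Lemma ext_zd_adj_sym x y : ext_zd_adj x y -> ext_zd_adj y x.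
Proof.
case=> neq [n [m [n0 m0 xy0 x0 y0]]]; split; first exact: nesym.
by exists m, n; split=> //; rewrite mulrC.
Qed.

Lemma ext_zd_adj_irrefl x : ~ ext_zd_adj x x.
Proof. by case. Qed.

Definition zd_graph : sgraph (zd_vertex R) :=
  SGraph zd_adj_sym zd_adj_irrefl.

Definition ext_zd_graph : sgraph (zd_vertex R) :=
  SGraph ext_zd_adj_sym ext_zd_adj_irrefl.

End Graphs.

(* The library has a ring structure on non-dependent finite functions only; this
   is the direct product of a family of rings, with componentwise operations. *)
Section ProductRing.

Variables (I : finType) (A : I -> comPzRingType).
Implicit Types x y z : {dffun forall i, A i}.

Definition prod_add x y : {dffun forall i, A i} := [ffun i => x i + y i].
Definition prod_opp x : {dffun forall i, A i} := [ffun i => - x i].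
Definition prod_zero : {dffun forall i, A i} := [ffun i => 0 : A i].
Definition prod_mul x y : {dffun forall i, A i} := [ffun i => x i * y i].
Definition prod_one : {dffun forall i, A i} := [ffun i => 1 : A i].

Fact prod_addA : associative prod_add.
Proof. by move=> x y z; apply/ffunP=> i; rewrite !ffunE addrA. Qed.
Fact prod_addC : commutative prod_add.
Proof. by move=> x y; apply/ffunP=> i; rewrite !ffunE addrC. Qed.
Fact prod_add0 : left_id prod_zero prod_add.
Proof. by move=> x; apply/ffunP=> i; rewrite !ffunE add0r. Qed.
Fact prod_addN : left_inverse prod_zero prod_opp prod_add.
Proof. by move=> x; apply/ffunP=> i; rewrite !ffunE addNr. Qed.
Fact prod_mulA : associative prod_mul.
Proof. by move=> x y z; apply/ffunP=> i; rewrite !ffunE mulrA. Qed.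
Fact prod_mulC : commutative prod_mul.
Proof. by move=> x y; apply/ffunP=> i; rewrite !ffunE mulrC. Qed.
Fact prod_mul1 : left_id prod_one prod_mul.
Proof. by move=> x; apply/ffunP=> i; rewrite !ffunE mul1r. Qed.
Fact prod_mulD : left_distributive prod_mul prod_add.
Proof. by move=> x y z; apply/ffunP=> i; rewrite !ffunE mulrDl. Qed.

HB.instance Definition _ := GRing.isZmodule.Build {dffun forall i, A i}
  prod_addA prod_addC prod_add0 prod_addN.
HB.instance Definition _ :=
  GRing.Zmodule_isComPzRing.Build {dffun forall i, A i}
    prod_mulA prod_mulC prod_mul1 prod_mulD.

End ProductRing.

Definition ring_iso (R S : pzRingType) : Prop :=
  exists f : {rmorphism R -> S}, bijective f.

(* {poly %/ p} quotients by 'X when p is not monic of size > 1; 'X^2 is, so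
   this is the intended quotient. *)
Definition Z2X_modX2 : comNzRingType := {poly %/ ('X^2 : {poly 'Z_2})}.

(* Main.v *)
Require Import Defs.
From HB Require Import structures.
From mathcomp Require Import all_boot all_order all_algebra.

(* If a is nonzero with a^2 = 0 and u is orthogonal to a, then u is either
   nilpotent or not. A nilpotent u must be -a, and then every zero-divisor lies
   in {0, a, -a}, so that the two graphs coincide. Otherwise some power of u is
   an idempotent e with a e = 0, and the absence of common neighbours says that
   a is the only nonzero nilpotent of (1 - e)R. Comparing the idempotents
   obtained for two square-zero elements shows that the nilradical of R is
   {0, a}. Splitting R along its primitive idempotents, the one that fixes a
   gives the ring {0, 1, a, 1 + a} and the others give fields. The converse
   exhibits an orthogonal vertex for each element of B x A_1 x ... x A_n. *)

Set Implicit Arguments.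
Unset Strict Implicit.
Unset Printing Implicit Defensive.

Import GRing.Theory.
Local Open Scope ring_scope.

(** * Extended adjacency on ring elements *)

Definition ext_adj (S : comPzRingType) (x y : S) : Prop :=
  x <> y /\
  exists n m : nat,
    [/\ (0 < n)%N, (0 < m)%N, x ^+ n * y ^+ m = 0, x ^+ n <> 0 & y ^+ m <> 0].

Definition ext_orth (S : comPzRingType) (x y : S) : Prop :=
  ext_adj x y /\ ~ exists w, ext_adj w x /\ ext_adj w y.

Lemma ext_adj_mul0 (S : comPzRingType) (x y : S) :
  x <> y -> x <> 0 -> y <> 0 -> x * y = 0 -> ext_adj x y.
Proof. by move=> xy x0 y0 xy0; split=> //; exists 1%N, 1%N; rewrite !expr1. Qed.

Lemma ext_adj_rmorph (S T : comPzRingType) (f : {rmorphism S -> T}) (x y : S) :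
  injective f -> ext_adj (f x) (f y) <-> ext_adj x y.
Proof.
move=> injf; have f0 z : f z = 0 <-> z = 0.
  by split=> [fz0|->]; [apply: injf; rewrite raddf0 | rewrite raddf0].
split=> -[xy [n [m [n0 m0 xy0 x0 y0]]]]; split.
- by move=> exy; apply: xy; rewrite exy.
- exists n, m; split=> //; move: xy0 x0 y0; rewrite -!rmorphXn -?rmorphM.
  + by move/f0.
  + by move=> _ + _ => h /f0.
  + by move=> _ _ + => h /f0.
- by move/injf.
- by exists n, m; split=> //; rewrite -!rmorphXn -?rmorphM; apply/f0.
Qed.

Lemma expr_neq0_base (S : pzRingType) (x : S) (n : nat) :
  (0 < n)%N -> x ^+ n <> 0 -> x <> 0.
Proof. by move=> n0 xn x0; apply: xn; rewrite x0 expr0n gtn_eqF. Qed.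

(** The last nonzero element among [y], [x * y], [x ^+ 2 * y], ... is killed by [x]. *)
Lemma zero_divisor_of_exp (S : comPzRingType) (x y : S) (n : nat) :
  x ^+ n * y = 0 -> y <> 0 -> exists2 z, z <> 0 & x * z = 0.
Proof.
elim: n y => [|n IH] y; first by rewrite expr0 mul1r.
rewrite exprSr -mulrA => h y0; have [xy0|/eqP xy0] := eqVneq (x * y) 0.
  by exists y.
exact: IH h xy0.
Qed.

Lemma vertexP (R : finComNzRingType) (x y : R) :
  x <> 0 -> y <> 0 -> x * y = 0 -> x \in zero_divisors R :\ 0.
Proof.
move=> /eqP x0 /eqP y0 xy0; rewrite !inE x0 /=.
by apply/existsP; exists y; rewrite y0 xy0 eqxx.
Qed.

Lemma ext_zd_adjE (R : finComNzRingType) (u v : zd_vertex R) :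
  ext_zd_adj u v <-> ext_adj (val u) (val v).
Proof.
split=> -[uv h]; split=> //; first by move/val_inj.
by move=> euv; apply: uv; rewrite euv.
Qed.

Lemma ext_adj_vertex (R : finComNzRingType) (x y : R) :
  ext_adj x y -> x \in zero_divisors R :\ 0.
Proof.
case=> _ [n [m [n0 m0 xy0 xn ym]]].
have [z z0 xz0] := zero_divisor_of_exp xy0 ym.
exact: vertexP (expr_neq0_base n0 xn) z0 xz0.
Qed.

Lemma ext_adj_sym (S : comPzRingType) (x y : S) : ext_adj x y -> ext_adj y x.
Proof.
case=> xy [n [m [n0 m0 xy0 xn ym]]]; split; first exact: nesym.
by exists m, n; rewrite mulrC.
Qed.

(** Vertices and common neighbours may range over all of [R], because an element with a neighbour is
    automatically a nonzero zero-divisor. *)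
Lemma complementedP (R : finComNzRingType) :
  complemented (ext_zd_graph R) <->
  forall x y : R, x <> 0 -> y <> 0 -> x * y = 0 -> exists u, ext_orth x u.
Proof.
split=> [cR x y x0 y0 xy0|h v].
  have [u [/ext_zd_adjE xu nw]] := cR (exist _ x (vertexP x0 y0 xy0)).
  exists (val u); split=> // -[w [wx wu]]; apply: nw.
  by exists (exist _ w (ext_adj_vertex wx)); split; apply/ext_zd_adjE.
have: val v \in zero_divisors R :\ 0 := valP v.
rewrite !inE => /andP[/eqP v0 /existsP[y /andP[/eqP y0 /eqP vy0]]].
have [u [vu nw]] := h _ _ v0 y0 vy0.
exists (exist _ u (ext_adj_vertex (ext_adj_sym vu))); split.
  exact/ext_zd_adjE.
by case=> w [/ext_zd_adjE wv /ext_zd_adjE wu]; apply: nw; exists (val w).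
Qed.

(** * Idempotent powers and last nonzero powers *)

(** By pigeonhole two powers of [x] agree, so the powers are eventually periodic. *)
Lemma exp_idempotent (R : finComNzRingType) (x : R) :
  exists2 N, (0 < N)%N & x ^+ N * x ^+ N = x ^+ N.
Proof.
have /injectivePn[i [j neq_ij eq_ij]] :
    ~~ injectiveb (fun i : 'I_#|R|.+1 => x ^+ i).
  by apply/negP => /injectiveP/leq_card; rewrite card_ord ltnn.
wlog lt_ij : i j neq_ij eq_ij / (i < j)%N.
  move=> H; have [|ji|/val_inj eij] := ltngtP i j; first exact: H.
    by apply: (H j i) => //; rewrite eq_sym.
  by rewrite eij eqxx in neq_ij.
move: eq_ij => /= eq_ij.
have per t k : x ^+ (i + k) = x ^+ (i + k + t * (j - i)).
  elim: t => [|t IH]; first by rewrite addn0.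
  rewrite IH mulSn; set p := (_ * _)%N.
  rewrite [RHS](_ : _ = x ^+ (j + (k + p))); last first.
    by rewrite [in LHS]addnA (addnAC i k) subnKC ?(ltnW lt_ij) // !addnA.
  by rewrite (exprD x j) -eq_ij -exprD addnA.
(* A multiple [N] of the period [j - i] with [N >= i] satisfies [x ^+ (N + N) = x ^+ N]; the factor
   [i.+1] keeps it positive even when [i] is 0. *)
exists (i.+1 * (j - i))%N; first by rewrite muln_gt0 /= subn_gt0.
have le_i : (i <= i.+1 * (j - i))%N.
  by rewrite (leq_trans (leqnSn i)) // leq_pmulr // subn_gt0.
rewrite -exprD; have := per i.+1 (i.+1 * (j - i) - i)%N.
by rewrite subnKC.
Qed.

Lemma idempotentX (R : pzRingType) (e : R) (n : nat) :
  e * e = e -> (0 < n)%N -> e ^+ n = e.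
Proof.
move=> ee; elim: n => // -[|n] IH _; first by rewrite expr1.
by rewrite exprS IH.
Qed.

Lemma last_exp (R : nzRingType) (x : R) (n : nat) :
  x ^+ n = 0 -> exists2 k, x ^+ k <> 0 & x ^+ k.+1 = 0.
Proof.
elim: n => [/eqP|n IH]; first by rewrite expr0 oner_eq0.
by have [/IH//|/eqP xn0 xSn0] := eqVneq (x ^+ n) 0; exists n.
Qed.

(** * Vertices orthogonal to a square-zero element *)

Lemma exprD_sq0 (R : comPzRingType) (u a : R) (k : nat) :
  u * a = 0 -> a * a = 0 -> (u + a) ^+ k.+2 = u ^+ k.+2.
Proof.
move=> ua aa; elim: k => [|k IH].
  by rewrite !expr2 mulrDl !mulrDr [a * u]mulrC ua aa !addr0.
by rewrite exprS IH mulrDl -exprS (exprS u k.+1) mulrA [a * u]mulrC ua mul0r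
  addr0.
Qed.

(* Otherwise the last nonzero power of u, or else u + a, is a common neighbour
   of a and u. *)
Lemma nilpotent_orth (R : comNzRingType) (a u : R) (k : nat) :
  a <> 0 -> a * a = 0 -> ext_orth a u -> u ^+ k = 0 -> u = - a.
Proof.
move=> a0 aa [[au [n [m [n0 m0 aum an um]]]] nw] uk0.
have n1 : n = 1%N.
  case: n n0 an {aum} => [//|[//|n]] _; case.
  by rewrite 2!exprS mulrA aa mul0r.
rewrite {}n1 expr1 in aum.
have u0 := expr_neq0_base m0 um.
have [l ul ulS] := last_exp uk0.
have lm : (m <= l)%N.
  rewrite leqNgt; apply/negP => lm; apply: um.
  by rewrite -(subnK lm) exprD ulS mulr0.
have aul : a * u ^+ l = 0 by rewrite -(subnK lm) addnC exprD mulrA aum mul0r.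
(* If [u * u = 0] then [l = 1], so [a * u = 0] and [u + a], if nonzero, annihilates both. *)
have [uu0|/eqP uu] := eqVneq (u * u) 0.
  have l1 : l = 1%N.
    case: l ul lm {ulS aul} => [_ lm|[//|l] ul _].
      by move: (leq_trans m0 lm).
    by case: ul; rewrite 2!exprS mulrA uu0 mul0r.
  rewrite l1 expr1 in aul.
  have [ua|/eqP ua] := eqVneq (u + a) 0.
    by apply/eqP; rewrite -addr_eq0 ua.
  case: nw; exists (u + a); split; apply: ext_adj_mul0 => //.
  - by move/eqP; rewrite -subr_eq0 addrK => /eqP.
  - by rewrite mulrDl aa [u * a]mulrC aul addr0.
  - by move/eqP; rewrite addrC -subr_eq0 addrK => /eqP.
  - by rewrite mulrDl uu0 aul addr0.
have ulu : u ^+ l * u = 0 by rewrite -exprSr.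
have ul_neq : u ^+ l <> u by move=> e; apply: uu; rewrite -{1}e.
have [ula|/eqP ula] := eqVneq (u ^+ l) a; last first.
  case: nw; exists (u ^+ l); split; apply: ext_adj_mul0 => //.
  by rewrite mulrC.
have ua0 : u * a = 0 by rewrite -ula -exprS.
have l2 : exists l', l = l'.+2.
  case: l lm {ul aul ulS ulu ula} ul_neq => [|[|l]] lm.
  - by move: (leq_trans m0 lm).
  - by case; rewrite expr1.
  - by exists l.
(* Here [u ^+ l] is [a] itself, which is not its own neighbour. Instead [u + a] kills [a], and its
   [l]-th power, again [a], kills [u]. *)
case: l2 => l' el; have wl : (u + a) ^+ l = a by rewrite el exprD_sq0 // -el.
have wa : (u + a) * a = 0 by rewrite mulrDl ua0 aa addr0.
have w0 : u + a <> 0 by move=> w0; apply: a0; rewrite -wl w0 el expr0n.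
case: nw; exists (u + a); split.
  apply: ext_adj_mul0 => //.
  by move/eqP; rewrite -subr_eq0 addrK => /eqP.
split; first by move/eqP; rewrite addrC -subr_eq0 addrK => /eqP.
exists l, 1%N; rewrite wl expr1; split=> //; last by rewrite mulrC.
by rewrite el.
Qed.

Lemma opp_orth_ann (R : comNzRingType) (a w : R) :
  a <> 0 -> ext_orth a (- a) -> w * a = 0 -> [\/ w = 0, w = a | w = - a].
Proof.
move=> a0 [_ nw] wa; have [->|/eqP w0] := eqVneq w 0; first exact: Or31.
have [->|/eqP na] := eqVneq w a; first exact: Or32.
have [->|/eqP nNa] := eqVneq w (- a); first exact: Or33.
case: nw; exists w; split; apply: ext_adj_mul0 => //.
  by move=> /eqP; rewrite oppr_eq0 => /eqP.
by rewrite mulrN wa oppr0.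
Qed.

(** Idempotents are trivial here and a unit is no zero-divisor, so [x] is nilpotent. This forces
    [x * a = 0], and only 0, [a] and [- a] kill [a]. *)
Lemma opp_orth_zero_divisors (R : finComNzRingType) (a x y : R) :
  a <> 0 -> a * a = 0 -> ext_orth a (- a) -> x * y = 0 -> y <> 0 ->
  [\/ x = 0, x = a | x = - a].
Proof.
move=> a0 aa oa xy y0; have ann := opp_orth_ann a0 oa.
(* An idempotent that kills [a] is 0, since [a] and [- a] square to 0. If [e] does not kill [a],
   then [e * a = a] and [1 - e] does. *)
have idem_e (e : R) : e * e = e -> e = 0 \/ e = 1.
  move=> ee; have e0 (f : R) : f * f = f -> f * a = 0 -> f = 0.
    move=> ff fa; by case: (ann f fa) => // fE; rewrite -ff fE ?mulrNN.
  have eaa : e * a * a = 0 by rewrite -mulrA aa mulr0.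
  have e1 : (1 - e) * (1 - e) = 1 - e.
    by rewrite mulrBl mul1r mulrBr mulr1 ee subrr subr0.
  have ea_e1 : e * a = a -> e = 1.
    move=> ea; apply/esym/eqP; rewrite -subr_eq0; apply/eqP/e0 => //.
    by rewrite mulrBl mul1r ea subrr.
  have [/(e0 _ ee)->|/ea_e1->|ea] := ann _ eaa; [by left|by right|right].
  by apply: ea_e1; rewrite -[LHS]opprK -mulrN -ea mulrA ee ea opprK.
have [N N0 /idem_e[xN|xN]] := exp_idempotent x; last first.
  by case: y0; rewrite -[y]mul1r -xN -(prednK N0) exprSr -mulrA xy mulr0.
(* The product [x * a] is again killed by [a]; if it were [a] or [- a], then [x * x * a = a],
   against nilpotency. *)
apply: (ann x); suff xxa : x * x * a <> a.
  have xaa : x * a * a = 0 by rewrite -mulrA aa mulr0.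
  case: (ann _ xaa) => // xa; case: xxa; rewrite -mulrA xa ?xa //.
  by rewrite mulrN xa opprK.
move=> xxa; case: a0; suff <- : (x * x) ^+ N * a = a.
  by rewrite exprMn xN !mul0r.
by elim: N {N0 xN} => [|N IH]; rewrite ?mul1r // exprS -mulrA IH.
Qed.

(** * The nilradical *)

(** The positive exponent keeps the square-zero element a multiple of [x], hence in every ideal
    containing [x]. *)
Lemma nilpotent_sq0 (R : comNzRingType) (x : R) (n : nat) :
  x ^+ n = 0 -> x <> 0 -> exists2 k, x ^+ k.+1 <> 0 & x ^+ k.+1 * x ^+ k.+1 = 0.
Proof.
move=> xn0 x0; have [[|k] xk xkS] := last_exp xn0.
  by case: x0; rewrite -[x]expr1.
by exists k => //; rewrite {1}exprSr -mulrA -exprS xkS mulr0.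
Qed.

Lemma zd_adj_ext (R : finComNzRingType) (u v : zd_vertex R) :
  zd_adj u v -> ext_zd_adj u v.
Proof.
have nz (w : zd_vertex R) : val w <> 0.
  by have /setD1P[/eqP] : val w \in zero_divisors R :\ 0 := valP w.
by case=> uv uv0; apply/ext_zd_adjE/ext_adj_mul0 => //; move/val_inj.
Qed.

(** Otherwise [R] is reduced, and [x ^+ n * y ^+ m = 0] gives [(x * y) ^+ (n + m) = 0], hence
    [x * y = 0], so the graphs agree. *)
Lemma exists_sq0 (R : finComNzRingType) :
  ~ same_graph (zd_graph R) (ext_zd_graph R) ->
  exists2 a : R, a <> 0 & a * a = 0.
Proof.
move=> neqG.
have [/existsP[a /andP[/eqP a0 /eqP aa]]|/existsPn red] :=
  boolP [exists a : R, (a != 0) && (a * a == 0)]; first by exists a.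
case: neqG => u v; split; first exact: zd_adj_ext.
case=> uv [n [m [_ _ uv0 _ _]]]; split=> //; apply/eqP/negPn/negP => /eqP uvn0.
have nil : (val u * val v) ^+ (n + m) = 0.
  rewrite exprMn exprD [val v ^+ _]exprD mulrACA [X in _ * X]mulrC mulrACA.
  by rewrite uv0 mul0r.
have [k k0 kk] := nilpotent_sq0 nil uvn0.
by case/negP: (red ((val u * val v) ^+ k.+1)); apply/andP; split; apply/eqP.
Qed.

Section Nilradical.

Variable R : finComNzRingType.
Hypothesis neqG : ~ same_graph (zd_graph R) (ext_zd_graph R).
Hypothesis complG : complemented (ext_zd_graph R).

(** Here [f] is [1 - e], with [e] the idempotent power of a vertex orthogonal to [a]. That [f <> 1]
    later provides a field factor. *)
Lemma sq0_idempotent (a : R) : a <> 0 -> a * a = 0 ->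
  exists f : R, [/\ f * f = f, f <> 1, f * a = a &
    forall x n, x ^+ n = 0 -> f * x = x -> x = 0 \/ x = a].
Proof.
move=> a0 aa; have [u au] := (complementedP R).1 complG a a a0 a0 aa.
have [N N0 NN] := exp_idempotent u.
have [uN|/eqP uN] := eqVneq (u ^+ N) 0.
  case: neqG => x y; split; first exact: zd_adj_ext.
  have uNa := nilpotent_orth a0 aa au uN; rewrite uNa in au.
  have sm (w : zd_vertex R) : [\/ val w = 0, val w = a | val w = - a].
    have /setD1P[_] : val w \in zero_divisors R :\ 0 := valP w.
    rewrite inE => /existsP[z /andP[/eqP z0 /eqP wz]].
    exact: opp_orth_zero_divisors a0 aa au wz z0.
  case=> xy _; split=> //.
  by case: (sm x) (sm y) => -> [] ->;
    rewrite ?mul0r ?mulr0 ?mulrN ?mulNr ?aa ?oppr0.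
have [[aneu [n [m [n0 m0 aum an um]]]] nw] := au.
have n1 : n = 1%N.
  case: n n0 an {aum} => [//|[//|n]] _; case.
  by rewrite 2!exprS mulrA aa mul0r.
rewrite {}n1 expr1 in aum.
set e := u ^+ N in NN uN.
(* Indeed [e = e ^+ m] is a power of [u ^+ m], which [a] kills. *)
have ae : a * e = 0.
  rewrite -(idempotentX NN m0) -exprM mulnC exprM.
  by rewrite -(prednK N0) exprS mulrA aum mul0r.
have fa : (1 - e) * a = a by rewrite mulrBl mul1r mulrC ae subr0.
(* Any other such [x] would be a common neighbour of [a] and [u], the latter through
   [u ^+ N = e]. *)
have sub x : a * x = 0 -> e * x = 0 -> x = 0 \/ x = a.
  move=> ax ex; have [->|/eqP x0] := eqVneq x 0; first by left.
  have [->|/eqP xa] := eqVneq x a; first by right.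
  case: nw; exists x; split; first by apply: ext_adj_mul0 => //; rewrite mulrC.
  split.
    move=> xu; apply: uN; rewrite -NN {2}/e.
    by rewrite -(prednK N0) exprS mulrA -xu ex mul0r.
  exists 1%N, N; rewrite expr1; split=> //.
  by rewrite mulrC.
exists (1 - e); split=> //.
- by rewrite mulrBl mul1r mulrBr mulr1 NN subrr subr0.
- move=> e1; apply: uN; apply: oppr_inj; rewrite oppr0.
  by apply: (addrI 1); rewrite addr0.
move=> x k xk fx; have ex : e * x = 0.
  by rewrite -fx mulrA mulrBr mulr1 NN subrr mul0r.
(* Applied to [x * a], [sub] leaves 0, as wanted, or [a], which would give [x ^+ k * a = a] for the
   nilpotent [x]. *)
apply: (sub x) => //; have [||//|xa] := sub (x * a).
- by rewrite mulrCA aa mulr0.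
- by rewrite mulrA ex mul0r.
- by rewrite mulrC.
- case: a0; rewrite -[RHS](mul0r a) -xk; elim: k {xk} => [|k IH].
    by rewrite mul1r.
  by rewrite exprSr -mulrA xa.
Qed.

Lemma nilradical_pair : exists a : R, [/\ a <> 0, a * a = 0,
  (forall x n, x ^+ n = 0 -> x = 0 \/ x = a) &
  exists f : R, [/\ f * f = f, f <> 0 & f <> 1]].
Proof.
have [a a0 aa] := exists_sq0 neqG.
have [f [ff f1 fa nilf]] := sq0_idempotent a0 aa.
exists a; split=> //; last first.
  by exists f; split=> // f0; apply: a0; rewrite -fa f0 mul0r.
move=> b k bk; have nilM g x i : x ^+ i = 0 -> (g * x : R) ^+ i = 0.
  by move=> xi; rewrite exprMn xi mulr0.
suff fb : f * b = b by apply: nilf bk fb.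
apply/eqP; rewrite -subr_eq0 -oppr_eq0 opprB; apply/negPn/negP => /eqP.
have -> : b - f * b = (1 - f) * b by rewrite mulrBl mul1r.
(* A nilpotent outside [fR] yields a nonzero square-zero [c] with [f * c = 0]; the idempotent [g] of
   [a + c] is then compared with [f]. *)
move=> b'0; have [j c0 cc] := nilpotent_sq0 (nilM (1 - f) _ _ bk) b'0.
set c := _ ^+ j.+1 in c0 cc.
have fc : f * c = 0.
  by rewrite /c exprS 2!mulrA mulrBr mulr1 ff subrr !mul0r.
have ac : a * c = 0 by rewrite -fa [f * a]mulrC -mulrA fc mulr0.
have dd : (a + c) * (a + c) = 0.
  by rewrite mulrDl !mulrDr aa cc [c * a]mulrC ac !addr0.
have fd : f * (a + c) = a by rewrite mulrDr fa fc addr0.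
have d0 : a + c <> 0 by move=> d0; apply: a0; rewrite -fd d0 mulr0.
have [g [gg g1 gd nilg]] := sq0_idempotent d0 dd.
have a2 : a ^+ 2 = 0 by rewrite expr2.
(* The nilpotent [g * a] is 0 or [a + c]; applying [f] gives [a = 0] in the first case and [c = 0]
   in the second. *)
have [||ga|ga] := nilg (g * a) 2%N; [exact: nilM|by rewrite mulrA gg| |].
- by apply: a0; rewrite -fd -gd mulrDr ga add0r mulrCA fc mulr0.
- by apply: c0; apply: (addrI a); rewrite addr0 -[RHS]fd -ga mulrCA fa.
Qed.

End Nilradical.

(** * The rings with elements 0, 1, [eps], [1 + eps] *)

(** Covers both local factors at once: [eps] is 2 in ['Z_4] and the class of ['X] in [Z2X_modX2]. *)
Definition dual_gen (B : comNzRingType) (eps : B) : Prop :=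
  [/\ eps <> 0, eps * eps = 0 &
      forall x, [\/ x = 0, x = 1, x = eps | x = 1 + eps]].

Section DualGen.

Variables (B : comNzRingType) (eps : B).
Hypothesis gen : dual_gen eps.

Definition dual_elt (p : bool * bool) : B := p.1%:R + eps * p.2%:R.

(** Multiplying by [eps] isolates the first coordinate. *)
Lemma dual_elt_inj : injective dual_elt.
Proof.
have [eps0 epsq _] := gen.
have inj_eps (s t : bool) : eps * s%:R = eps * t%:R -> s = t.
  by case: s; case: t => //; rewrite mulr1 mulr0 => // /esym.
move=> [s t] [s' t']; rewrite /dual_elt /= => e.
have es : s = s'.
  apply: inj_eps; have := congr1 (fun z => eps * z) e.
  by rewrite !mulrDr !mulrA epsq !mul0r !addr0.
by rewrite es in e *; rewrite (inj_eps _ _ (addrI _ e)).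
Qed.

Lemma dual_elt_surj (x : B) : exists p, dual_elt p = x.
Proof.
have [_ _ /(_ x)[]->] := gen; rewrite /dual_elt.
- by exists (false, false); rewrite mulr0 addr0.
- by exists (true, false); rewrite mulr0 addr0.
- by exists (false, true); rewrite mulr1 add0r.
- by exists (true, true); rewrite mulr1.
Qed.

(** The values 1 and [1 + eps] are excluded, as they give [1 = 0] and [eps = 1]. This boolean is the
    only freedom left in the ring structure. *)
Lemma dual_two : 1 + 1 = eps * (1 + 1 != 0 :> B)%:R.
Proof.
have [eps0 epsq /(_ (1 + 1))[] two] := gen.
- by rewrite two eqxx mulr0.
- by move/eqP: two; rewrite -subr_eq0 addrK oner_eq0.
- by rewrite two; move/eqP: eps0 => ->; rewrite mulr1.
- by move: epsq => /eqP; rewrite -(addrI _ two) mulr1 oner_eq0.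
Qed.

Lemma dual_eps2 : eps + eps = 0.
Proof.
have [_ epsq _] := gen.
by rewrite -[eps]mulr1 -mulrDr dual_two mulrA epsq mul0r.
Qed.

(* The last boolean is the carry 1 + 1 = eps of Z/4; it is false in Z/2[X]/X^2. *)
Lemma dual_eltD (p q : bool * bool) : dual_elt p + dual_elt q =
  dual_elt (p.1 (+) q.1, p.2 (+) q.2 (+) [&& 1 + 1 != 0 :> B, p.1 & q.1]).
Proof.
have epsD (s t : bool) : eps * s%:R + eps * t%:R = eps * (s (+) t)%:R.
  by case: s; case: t; rewrite ?mulr1 ?mulr0 ?addr0 ?add0r ?dual_eps2.
have oneD (s t : bool) :
    s%:R + t%:R = (s (+) t)%:R + eps * [&& 1 + 1 != 0 :> B, s & t]%:R.
  case: s; case: t; rewrite ?andbF ?mulr0 ?addr0 ?add0r //= andbT.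
  by rewrite -dual_two.
case: p q => [s t] [s' t']; rewrite /dual_elt /= addrACA oneD epsD.
by rewrite -addrA epsD (addbC _ (t (+) t')).
Qed.

Lemma dual_eltM (p q : bool * bool) : dual_elt p * dual_elt q =
  dual_elt (p.1 && q.1, (p.1 && q.2) (+) (p.2 && q.1)).
Proof.
have [_ epsq _] := gen.
case: p q => [s t] [s' t']; rewrite /dual_elt /=.
rewrite mulrDl !mulrDr (mulrCA _ eps) mulrACA epsq mul0r addr0 -!mulrA.
rewrite -addrA -mulrDr -!natrM !mulnb; congr (_ + _).
case: (s && t'); case: (t && s'); rewrite ?addr0 ?add0r //.
by rewrite mulrDr mulr1 dual_eps2 mulr0.
Qed.

Definition dual_coord (x : B) : bool * bool :=
  odflt (false, false) [pick p | dual_elt p == x].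

Lemma dual_coordK : cancel dual_coord dual_elt.
Proof.
move=> x; rewrite /dual_coord; case: pickP => [p /eqP//|noP].
by have [p px] := dual_elt_surj x; move: (noP p); rewrite px eqxx.
Qed.

Lemma dual_eltK : cancel dual_elt dual_coord.
Proof. by move=> p; apply: dual_elt_inj; rewrite dual_coordK. Qed.

End DualGen.

(** In coordinates both operations depend only on whether [1 + 1 = 0], so matching coordinates is an
    isomorphism. *)
Lemma dual_iso (B C : comNzRingType) (eps : B) (del : C) :
  dual_gen eps -> dual_gen del ->
  (1 + 1 == 0 :> B) = (1 + 1 == 0 :> C) -> ring_iso B C.
Proof.
move=> gB gC two; pose f x := dual_elt del (dual_coord eps x).
have fE p : f (dual_elt eps p) = dual_elt del p by rewrite /f dual_eltK.
have f0 : f 0 = 0.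
  have -> : 0 = dual_elt eps (false, false) by rewrite /dual_elt mulr0 addr0.
  by rewrite fE /dual_elt mulr0 addr0.
have f1 : f 1 = 1.
  have -> : 1 = dual_elt eps (true, false) by rewrite /dual_elt mulr0 addr0.
  by rewrite fE /dual_elt mulr0 addr0.
have fD : {morph f : x y / x + y}.
  move=> x y; rewrite -(dual_coordK gB x) -(dual_coordK gB y).
  by rewrite (dual_eltD gB) !fE (dual_eltD gC) two.
have fM : {morph f : x y / x * y}.
  move=> x y; rewrite -(dual_coordK gB x) -(dual_coordK gB y).
  by rewrite (dual_eltM gB) !fE (dual_eltM gC).
pose F : {rmorphism B -> C} := HB.pack f
  (GRing.isNmodMorphism.Build B C f (f0, fD))
  (GRing.isMonoidMorphism.Build B C f (f1, fM)).
exists F; exists (dual_elt eps \o dual_coord del) => x /=.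
  by rewrite dual_eltK // dual_coordK.
by rewrite /F /= fE dual_coordK.
Qed.

Lemma dual_gen_iso (B C : comNzRingType) (del : C) :
  ring_iso B C -> dual_gen del -> exists eps : B, dual_gen eps.
Proof.
case=> f [g fK gK] [del0 delq gen]; have injf := can_inj fK.
exists (g del); split.
- by move=> g0; apply: del0; rewrite -(gK del) g0 rmorph0.
- by apply: injf; rewrite rmorphM rmorph0 gK.
move=> x; case: (gen (f x)) => fx.
- by apply: Or41; apply: injf; rewrite fx rmorph0.
- by apply: Or42; apply: injf; rewrite fx rmorph1.
- by apply: Or43; apply: injf; rewrite fx gK.
- by apply: Or44; apply: injf; rewrite fx rmorphD rmorph1 gK.
Qed.

Lemma dual_gen_Z4 : dual_gen (2%:R : 'Z_4).
Proof.
split; [by []|exact: val_inj|].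
case=> [[|[|[|[|//]]]]] lt.
- by apply: Or41; apply: val_inj.
- by apply: Or42; apply: val_inj.
- by apply: Or43; apply: val_inj.
- by apply: Or44; apply: val_inj.
Qed.

Lemma dual_gen_Z2X : dual_gen ('qX : {poly %/ ('X^2 : {poly 'Z_2})}).
Proof.
have valX : ('qX : {poly %/ ('X^2 : {poly 'Z_2})}) = 'X :> {poly 'Z_2}.
  by rewrite qpolyXE ?size_polyXn ?monicXn.
have mX2 : mk_monic ('X^2 : {poly 'Z_2}) = 'X^2 by rewrite mk_monic_Xn.
split.
- by move=> q0; have /eqP := valX; rewrite q0 eq_sym polyX_eq0.
- apply: val_inj; rewrite [LHS]poly_of_qpolyM valX [in LHS]mX2 -expr2.
  by rewrite Pdiv.RingMonic.rmodpp ?monicXn.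
move=> x; have sx : (size (val x : {poly 'Z_2}) <= 2)%N.
  have := size_mk_monic x.
  by rewrite [X in (_ < size (polyseq X))%N]mX2 size_polyXn.
have xE : val x = ((val x)`_0)%:P + (val x)`_1 *: 'X :> {poly 'Z_2}.
  apply/polyP=> -[|[|i]]; rewrite coefD coefC coefZ coefX /=;
    rewrite ?mulr0 ?mulr1 ?addr0 ?add0r //.
  by rewrite nth_default // (leq_trans sx).
have Z2 (c : 'Z_2) : c = 0 \/ c = 1.
  by case: c => [[|[|//]]] lt; [left|right]; apply: val_inj.
move: xE; move: (_`_0) (_`_1) => c0 c1.
case: (Z2 c0) => ->; case: (Z2 c1) => -> xE.
- by apply: Or41; apply: val_inj; rewrite xE scale0r addr0.
- by apply: Or43; apply: val_inj; rewrite xE scale1r add0r; exact/esym/valX.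
- by apply: Or42; apply: val_inj; rewrite xE scale0r addr0.
- by apply: Or44; apply: val_inj; rewrite xE scale1r -[X in 1 + X = _]valX.
Qed.

Lemma dual_genP (B : comNzRingType) :
  (exists eps : B, dual_gen eps) <-> ring_iso B 'Z_4 \/ ring_iso B Z2X_modX2.
Proof.
split=> [[eps gen]|[] iso]; last 2 first.
- exact: dual_gen_iso iso dual_gen_Z4.
- exact: dual_gen_iso iso dual_gen_Z2X.
have [two|two] := eqVneq (1 + 1 : B) 0; [right|left].
  apply: (dual_iso gen dual_gen_Z2X); rewrite two eqxx; apply/esym/eqP.
  apply: val_inj; apply/polyP=> i; rewrite /= coefD coef1 coef0.
  by case: (i == 0)%N; rewrite ?addr0 //; apply: val_inj.
by apply: (dual_iso gen dual_gen_Z4); rewrite (negbTE two).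
Qed.

(** * Corner rings and the product decomposition *)

Record idempotent (R : finComNzRingType) := Idempotent {
  idem_val :> R;
  idem_sq : idem_val * idem_val = idem_val;
  idem_neq0 : idem_val != 0
}.

(* The ring eR, whose unit is e. *)
Record corner (R : finComNzRingType) (e : idempotent R) : predArgType :=
Corner {
  corner_val :> R;
  corner_valP : (e : R) * corner_val == corner_val
}.

Section CornerRing.

Variables (R : finComNzRingType) (e : idempotent R).
Implicit Types x y z : corner e.

HB.instance Definition _ := [isSub for @corner_val R e].
HB.instance Definition _ := [Finite of corner e by <:].

Lemma cornerE x : (e : R) * corner_val x = corner_val x.
Proof. exact/eqP/corner_valP. Qed.

Lemma to_corner_subproof (x : R) : (e : R) * ((e : R) * x) == (e : R) * x.
Proof. by rewrite mulrA idem_sq. Qed.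

Definition to_corner (x : R) : corner e := Corner (to_corner_subproof x).

(** Ending each operation with the projection [to_corner] gives membership in [eR] for free; by
    [corner_valD] and [corner_valM] it does not alter sums and products. *)
Definition corner_add x y := to_corner (val x + val y).
Definition corner_opp x := to_corner (- val x).
Definition corner_mul x y := to_corner (val x * val y).

Fact corner_addA : associative corner_add.
Proof.
move=> x y z; apply: val_inj.
by rewrite /= !mulrDr !mulrA !idem_sq !cornerE addrA.
Qed.
Fact corner_addC : commutative corner_add.
Proof. by move=> x y; apply: val_inj; rewrite /= addrC. Qed.
Fact corner_add0 : left_id (to_corner 0) corner_add.
Proof. by move=> x; apply: val_inj; rewrite /= mulr0 add0r cornerE. Qed.
Fact corner_addN : left_inverse (to_corner 0) corner_opp corner_add.
Proof. by move=> x; apply: val_inj; rewrite /= mulrN cornerE addNr. Qed.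
Fact corner_mulA : associative corner_mul.
Proof.
move=> x y z; apply: val_inj.
by rewrite /= !mulrA !idem_sq !cornerE [val x * idem_val _]mulrC cornerE.
Qed.
Fact corner_mulC : commutative corner_mul.
Proof. by move=> x y; apply: val_inj; rewrite /= [val x * _]mulrC. Qed.
Fact corner_mul1 : left_id (to_corner 1) corner_mul.
Proof. by move=> x; apply: val_inj; rewrite /= mulr1 !cornerE. Qed.
Fact corner_mulD : left_distributive corner_mul corner_add.
Proof.
move=> x y z; apply: val_inj; rewrite /= (mulrDr _ (val x)) !cornerE -mulrDr.
by rewrite -mulrDl [RHS]mulrA idem_sq.
Qed.
Fact corner_1neq0 : to_corner 1 != to_corner 0.
Proof. by rewrite -val_eqE /= mulr1 mulr0 idem_neq0. Qed.

HB.instance Definition _ := GRing.isZmodule.Build (corner e)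
  corner_addA corner_addC corner_add0 corner_addN.
HB.instance Definition _ := GRing.Zmodule_isComNzRing.Build (corner e)
  corner_mulA corner_mulC corner_mul1 corner_mulD corner_1neq0.

Lemma corner_val0 : val (0 : corner e) = 0. Proof. exact: mulr0. Qed.
Lemma corner_val1 : val (1 : corner e) = e. Proof. exact: mulr1. Qed.
Lemma corner_valD x y : val (x + y) = val x + val y.
Proof. by rewrite [LHS]mulrDr !cornerE. Qed.
Lemma corner_valM x y : val (x * y) = val x * val y.
Proof. by rewrite [LHS]mulrA cornerE. Qed.

Lemma to_corner_is_nmod_morphism :
  to_corner 0 = 0 /\ {morph to_corner : x y / x + y}.
Proof.
split=> [//|x y]; apply: val_inj.
by rewrite corner_valD /= mulrDr.
Qed.

Lemma to_corner_is_monoid_morphism :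
  to_corner 1 = 1 /\ {morph to_corner : x y / x * y}.
Proof.
split=> [//|x y]; apply: val_inj.
by rewrite corner_valM /= mulrACA idem_sq.
Qed.

HB.instance Definition _ := GRing.isNmodMorphism.Build R (corner e) to_corner
  to_corner_is_nmod_morphism.
HB.instance Definition _ := GRing.isMonoidMorphism.Build R (corner e) to_corner
  to_corner_is_monoid_morphism.

End CornerRing.

(** Invertibility is part of the record so that each member of a family of such idempotents carries
    a canonical field structure. *)
Record field_idempotent (R : finComNzRingType) := FieldIdempotent {
  field_idem_val :> idempotent R;
  field_idem_inv :
    forall x : corner field_idem_val, x != 0 -> exists y, y * x = 1
}.

Definition field_corner (R : finComNzRingType) (e : field_idempotent R) :
  Type := corner e.

Section FieldCorner.

Variables (R : finComNzRingType) (e : field_idempotent R).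

HB.instance Definition _ := Finite.on (field_corner e).
HB.instance Definition _ := GRing.ComNzRing.on (field_corner e).

(** The default is reached only at [x = 0]. *)
Definition field_corner_inv (x : field_corner e) : field_corner e :=
  odflt 0 [pick y | y * x == 1].

Fact field_corner_mulVf x : x != 0 -> field_corner_inv x * x = 1.
Proof.
move=> /field_idem_inv[y yx]; rewrite /field_corner_inv.
by case: pickP => [z /eqP//|/(_ y)]; rewrite yx eqxx.
Qed.

Fact field_corner_inv0 : field_corner_inv 0 = 0.
Proof.
rewrite /field_corner_inv; case: pickP => // y.
by rewrite mulr0 eq_sym oner_eq0.
Qed.

HB.instance Definition _ := GRing.ComNzRing_isField.Build (field_corner e)
  field_corner_mulVf field_corner_inv0.

End FieldCorner.

(** The inverse map adds up the components: orthogonality separates them again, and the idempotents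
    summing to 1 recover [x]. *)
Lemma corner_decomposition (R : finComNzRingType) (n : nat)
    (e0 : idempotent R) (e : 'I_n -> field_idempotent R) :
  (forall i, (e0 : R) * (e i : R) = 0) ->
  (forall i j, i != j -> (e i : R) * (e j : R) = 0) ->
  (e0 : R) + \sum_i (e i : R) = 1 ->
  ring_iso R
    (corner e0 * {dffun forall i, (field_corner (e i) : finFieldType)})%type.
Proof.
move=> e0e ee sum1; pose A i : finFieldType := field_corner (e i).
pose f (x : R) : (corner e0 * {dffun forall i, A i})%type :=
  (to_corner e0 x, [ffun i => to_corner (e i) x : A i]).
have fD : f 0 = 0 /\ {morph f : x y / x + y}.
  split=> [|x y]; congr (_, _); rewrite ?rmorph0 ?rmorphD //; apply/ffunP=> i.
  by rewrite !ffunE; exact: (to_corner_is_nmod_morphism (e i)).2.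
have fM : f 1 = 1 /\ {morph f : x y / x * y}.
  split=> [|x y]; congr (_, _); rewrite ?rmorph1 ?rmorphM //; apply/ffunP=> i.
  by rewrite !ffunE; exact: (to_corner_is_monoid_morphism (e i)).2.
pose S := (corner e0 * {dffun forall i, A i})%type.
pose F : {rmorphism R -> S} := HB.pack f
  (GRing.isNmodMorphism.Build R S f fD) (GRing.isMonoidMorphism.Build R S f fM).
pose g (p : corner e0 * {dffun forall i, A i}) : R :=
  val p.1 + \sum_i corner_val (p.2 i : corner (e i)).
exists F; exists g.
  move=> x; rewrite /g /F /= -[RHS]mul1r -sum1 mulrDl mulr_suml.
  by congr (_ + _); apply: eq_bigr => i _; rewrite ffunE.
move=> [b a]; congr (_, _).
  apply: val_inj; rewrite /= mulrDr cornerE mulr_sumr big1 ?addr0 // => i _.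
  by rewrite -cornerE mulrA e0e mul0r.
apply/ffunP=> i; rewrite ffunE; apply: val_inj; rewrite /= mulrDr.
rewrite -[X in _ * X]cornerE mulrA [(e i : R) * _]mulrC e0e mul0r add0r.
rewrite mulr_sumr (bigD1 i) //= cornerE big1 ?addr0 // => j ji.
by rewrite -cornerE mulrA ee 1?eq_sym // mul0r.
Qed.

(** * Primitive idempotents *)

Definition prim_idem (R : finComNzRingType) (e : R) : bool :=
  [&& e != 0, e * e == e &
      [forall f : R, (f * f == f) ==> (e * f == 0) || (e * f == e)]].

Lemma prim_idemP (R : finComNzRingType) (e : R) : prim_idem e ->
  [/\ e != 0, e * e = e & forall f, f * f = f -> e * f = 0 \/ e * f = e].
Proof.
case/and3P=> e0 /eqP ee /forallP fP; split=> // f ff.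
by have := fP f; rewrite ff eqxx => /orP[] /eqP; [left|right].
Qed.

(** Otherwise [e * f] equals both [e] and [f]. *)
Lemma prim_idem_orth (R : finComNzRingType) (e f : R) :
  prim_idem e -> prim_idem f -> e != f -> e * f = 0.
Proof.
move=> /prim_idemP[_ ee eP] /prim_idemP[_ ff fP] ef.
case: (eP f ff) => // efe; case: (fP e ee) => [|fe]; first by rewrite mulrC.
by case/eqP: ef; rewrite -efe mulrC.
Qed.

Lemma exists_prim_idem (R : finComNzRingType) (g : R) :
  g * g = g -> g <> 0 -> exists2 e, prim_idem e & g * e = e.
Proof.
move=> gg /eqP g0; pose P f := [&& f != 0, f * f == f & g * f == f].
have Pg : P g by rewrite /P g0 gg eqxx.
(* An idempotent e below g for which eR has the fewest elements is primitive. *)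
case: (arg_minnP (fun f => #|[set x | f * x == x]|) Pg) => e.
case/and3P=> e0 /eqP ee /eqP ge min_e; exists e => //.
rewrite /prim_idem e0 ee eqxx /=; apply/forallP=> h; apply/implyP=> /eqP hh.
have [//|eh0 /=] := eqVneq (e * h) 0.
have ehe : e * h * (e * h) = e * h by rewrite mulrACA ee hh.
have /min_e le : P (e * h) by rewrite /P eh0 ehe mulrA ge !eqxx.
have sub : [set x | e * h * x == x] \subset [set x | e * x == x].
  apply/subsetP=> x; rewrite !inE => /eqP xE.
  by rewrite -xE !mulrA ee.
(* By minimality [e * h] fixes the same elements as [e], in particular [e] itself. *)
have /setP/(_ e) : [set x | e * h * x == x] = [set x | e * x == x].
  by apply/eqP; rewrite eqEcard sub.
by rewrite !inE ee eqxx mulrAC ee.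
Qed.

(** The sum [s] is idempotent and fixes every primitive idempotent, so none lies below [1 - s],
    which must vanish. *)
Lemma sum_prim_idem (R : finComNzRingType) : \sum_(e : R | prim_idem e) e = 1.
Proof.
set s := \sum_(e | _) e.
have es (e : R) : prim_idem e -> e * s = e.
  move=> pe; rewrite /s mulr_sumr (bigD1 e) //=.
  have [_ -> _] := prim_idemP pe.
  rewrite big1 ?addr0 // => f /andP[pf fe].
  by apply: prim_idem_orth; rewrite // eq_sym.
have ss : s * s = s by rewrite {1}/s mulr_suml; apply: eq_bigr.
apply/eqP; rewrite -subr_eq0 -oppr_eq0 opprB; apply/negPn/negP => /eqP s1.
have [|e pe] := exists_prim_idem _ s1.
  by rewrite mulrBl mul1r mulrBr mulr1 ss subrr subr0.
rewrite mulrBl mul1r mulrC es // subrr => e0.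
by have [] := prim_idemP pe; rewrite -e0 eqxx.
Qed.

Lemma prim_idem_nilp_unit (R : finComNzRingType) (e x : R) :
  prim_idem e -> e * x = x -> exists2 n, (0 < n)%N & x ^+ n = 0 \/ x ^+ n = e.
Proof.
move=> /prim_idemP[_ _ eP] ex; have [n n0 nn] := exp_idempotent x.
exists n => //; have -> : x ^+ n = e * x ^+ n.
  by rewrite -(prednK n0) exprS mulrA ex.
exact: eP.
Qed.

(** A nonzero [x] is not nilpotent, so [x ^+ n = e] for some positive [n], and [x ^+ n.-1],
    projected to [eR], is an inverse. *)
Lemma prim_idem_field (R : finComNzRingType) (e : idempotent R) :
  prim_idem e -> (forall (x : R) n, x ^+ n = 0 -> (e : R) * x = x -> x = 0) ->
  forall x : corner e, x != 0 -> exists y, y * x = 1.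
Proof.
move=> pe red x x0; have [n n0 []] := prim_idem_nilp_unit pe (cornerE x).
  move=> /red/(_ (cornerE x)) x00; case/eqP: x0.
  by apply: val_inj; rewrite corner_val0.
move=> xn; exists (to_corner e ((x : R) ^+ n.-1)); apply: val_inj.
by rewrite corner_valM corner_val1 /= -mulrA -exprSr prednK // xn idem_sq.
Qed.

(** A non-nilpotent [x] has a power equal to [e], so it cannot kill [a]. Then [x * a = a], so
    [x - e] kills [a] and is therefore nilpotent, that is 0 or [a]. *)
Lemma prim_idem_dual (R : finComNzRingType) (e : idempotent R) (a : R) :
  prim_idem e -> a <> 0 -> a * a = 0 -> (e : R) * a = a ->
  (forall (x : R) n, x ^+ n = 0 -> x = 0 \/ x = a) ->
  exists eps : corner e, dual_gen eps.
Proof.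
move=> pe a0 aa ea nil; exists (to_corner e a); split.
- by move=> /(congr1 val); rewrite corner_val0 /= ea.
- by apply: val_inj; rewrite corner_valM corner_val0 /= ea.
move=> x; have expa (y : R) n :
    y * a = 0 -> (0 < n)%N -> y ^+ n = (e : R) -> False.
  move=> ya n0 yn; apply: a0; rewrite -ea -yn -(prednK n0) exprSr -mulrA ya.
  by rewrite mulr0.
have [n n0 [/nil[]|xn]] := prim_idem_nilp_unit pe (cornerE x).
- by move=> x0; apply: Or41; apply: val_inj; rewrite corner_val0.
- by move=> xa; apply: Or43; apply: val_inj; rewrite /= ea.
have [|xa0|xa] := nil ((x : R) * a) 2%N.
- by rewrite exprMn [a ^+ 2]expr2 aa mulr0.
- by case: (expa _ _ xa0 n0 xn).
have ya : ((x : R) - (e : R)) * a = 0 by rewrite mulrBl xa ea subrr.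
have ey : (e : R) * ((x : R) - (e : R)) = val x - (e : R).
  by rewrite mulrBr cornerE idem_sq.
have [m m0 [/nil[]|ym]] := prim_idem_nilp_unit pe ey.
- move/eqP; rewrite subr_eq0 => /eqP xe; apply: Or42.
  by apply: val_inj; rewrite corner_val1.
- move=> xe; apply: Or44; apply: val_inj.
  by rewrite corner_valD corner_val1 /= ea -xe addrC subrK.
- by case: (expa _ _ ya m0 ym).
Qed.

Lemma nilradical_pair_decomposition (R : finComNzRingType) (a f : R) :
  a <> 0 -> a * a = 0 -> (forall (x : R) n, x ^+ n = 0 -> x = 0 \/ x = a) ->
  f * f = f -> f <> 0 -> f <> 1 ->
  exists (n : nat) (B : comNzRingType) (A : 'I_n -> finFieldType),
    [/\ (1 <= n)%N, ring_iso B 'Z_4 \/ ring_iso B Z2X_modX2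
      & ring_iso R (B * {dffun forall i : 'I_n, A i})%type].
Proof.
move=> a0 aa nil ff f0 f1.
(* The element [a] is the sum of the [e * a] over primitive [e], and each of these is 0 or [a]. *)
have [e0 pe0 e0a] : exists2 e : R, prim_idem e & e * a = a.
  have [/existsP[e /andP[pe /eqP ea]]|/existsPn no] :=
    boolP [exists e : R, prim_idem e && (e * a == a)]; first by exists e.
  case: a0; rewrite -[a]mul1r -sum_prim_idem mulr_suml big1 // => e pe.
  have [|//|ea] := nil (e * a) 2%N.
    by rewrite exprMn [a ^+ 2]expr2 aa mulr0.
  by move: (no e); rewrite pe ea eqxx.
have [e0n0 e0e0 e0P] := prim_idemP pe0.
pose E := [set e : R | prim_idem e && (e != e0)].
have EP (i : 'I_#|E|) : prim_idem (enum_val i) /\ enum_val i != e0.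
  by have := enum_valP i; rewrite inE => /andP.
have sq (i : 'I_#|E|) : enum_val i * enum_val i = enum_val i.
  by have [/prim_idemP[]] := EP i.
have nz (i : 'I_#|E|) : enum_val i != 0 by have [/prim_idemP[]] := EP i.
have inv (i : 'I_#|E|) :=
  @prim_idem_field _ (Idempotent (sq i) (nz i)) (EP i).1.
(* The other primitive idempotents are orthogonal to [e0], which fixes [a], so they kill [a]. *)
have red (i : 'I_#|E|) (x : R) n : x ^+ n = 0 -> enum_val i * x = x -> x = 0.
  have [pe ne0] := EP i; move=> /nil[//|->].
  by rewrite -{1}e0a mulrA (prim_idem_orth pe pe0 ne0) mul0r => <-.
pose e i := FieldIdempotent (inv i (red i)).
pose b := Idempotent e0e0 e0n0.
exists #|E|, (corner b), (fun i => field_corner (e i)); split.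
(* If [e0] were the only primitive idempotent it would be 1, and [f] would be trivial. *)
- rewrite lt0n; apply/negP => /eqP/cards0_eq E0.
  have e01 : e0 = 1.
    rewrite -(sum_prim_idem R) (bigD1 e0) //= big1 ?addr0 // => g pg.
    by have := in_set0 g; rewrite -E0 inE pg.
  by case: (e0P f ff); rewrite e01 mul1r.
- exact/dual_genP/(prim_idem_dual (e := b) pe0 a0 aa).
- apply: corner_decomposition => [i|i j ij|] /=.
  + by rewrite prim_idem_orth // 1?eq_sym; case: (EP i).
  + rewrite prim_idem_orth ?(inj_eq enum_val_inj) //.
      by case: (EP i).
    by case: (EP j).
  + rewrite -(sum_prim_idem R) (bigD1 e0) //=; congr (_ + _).
    rewrite -[LHS](big_enum_val id).
    by apply: eq_bigl => g; rewrite inE.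
Qed.

(** * The converse: orthogonal vertices in the product *)

Lemma inv_exp_mul0 (S : comNzRingType) (x y z : S) n :
  x * y = 1 -> x ^+ n * z = 0 -> z = 0.
Proof.
by move=> xy xz; rewrite -[z]mul1r -(expr1n S n) -xy exprMn mulrAC xz mul0r.
Qed.

Section Converse.

Variables (n : nat) (B : comNzRingType) (A : 'I_n -> finFieldType) (eps : B).
Hypotheses (n_gt0 : (0 < n)%N) (gen : dual_gen eps).

Local Notation P := {dffun forall i : 'I_n, A i}.
Implicit Types a d : P.

Lemma dual_gen_inv (b : B) : b <> 0 -> b <> eps -> exists c, b * c = 1.
Proof.
have [_ epsq /(_ b)[]// ->] := gen => _ _; first by exists 1; rewrite mulr1.
by exists (1 - eps); rewrite mulrBr mulr1 mulrDl mul1r epsq addr0 addrK.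
Qed.

Lemma dffun_expE a k i : (a ^+ k) i = a i ^+ k.
Proof.
elim: k => [|k IH]; first by rewrite !expr0 ffunE.
by rewrite !exprS ffunE IH.
Qed.

Lemma pair_expE (v : B * P) k : v ^+ k = (v.1 ^+ k, v.2 ^+ k).
Proof.
elim: k => [|k IH]; first by rewrite !expr0.
by rewrite !exprS IH.
Qed.

Definition cosupport a : P := [ffun i => (a i == 0)%:R].

Lemma cosupport_mul0 a : a * cosupport a = 0.
Proof.
apply/ffunP=> i; rewrite !ffunE; case: eqP => [->|_]; last by rewrite mulr0.
by rewrite mul0r.
Qed.

Lemma cosupport_neq a : a <> cosupport a.
Proof.
move/ffunP/(_ (Ordinal n_gt0)); rewrite ffunE; case: eqP => // -> /eqP.
by rewrite eq_sym oner_eq0.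
Qed.

(** At each [i] one of [a i] and [cosupport a i] is nonzero, and [A i] is a field. *)
Lemma cosupport_ann a d k l p q :
  d ^+ k * a ^+ l = 0 -> d ^+ p * cosupport a ^+ q = 0 -> d = 0.
Proof.
move=> /ffunP da /ffunP dc; apply/ffunP=> i; apply/eqP.
move: (da i) (dc i); rewrite !ffunE !dffun_expE ffunE => /eqP + /eqP.
rewrite !mulf_eq0 !expf_eq0; case: (d i == 0) => //.
by rewrite !andbF /=; case: (a i == 0); rewrite ?oner_eq0 ?andbF.
Qed.

(* For v = (b, a) the vertex is (1, cosupport a) if b is nilpotent and a nonzero,
   and (0, cosupport a) otherwise. *)
Lemma exists_ext_orth (v w : B * P) :
  v <> 0 -> w <> 0 -> v * w = 0 -> exists u, ext_orth v u.
Proof.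
case: v w => [b a] [c d] v0 w0 vw0.
have [bc0 ad0] : b * c = 0 /\ a * d = 0 by case: vw0.
have a_or : b = 0 \/ b = eps /\ a <> 0 -> a <> 0.
  by case=> [b0|[]//] a0; apply: v0; rewrite b0 a0.
have [bE|bE] : (b = 0 \/ b = eps /\ a <> 0) \/
    (exists c, b * c = 1) \/ (b = eps /\ a = 0).
  have [b0|/eqP b0] := eqVneq b 0; first by left; left.
  have [be|/eqP be] := eqVneq b eps; last by right; left; exact: dual_gen_inv.
  by have [a0|/eqP a0] := eqVneq a 0; [right; right|left; right].
- have {}a_or := a_or bE; have [_ epsq _] := gen.
  have bb : b * b = 0 by case: bE => [->|[-> _]//]; rewrite mul0r.
  exists (1, cosupport a); split.
    split; first by case=> _; exact: cosupport_neq.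
    (* Squaring removes the first component, which may be [eps], and keeps the second nonzero. *)
    exists 2%N, 1%N; rewrite expr1 expr2; split=> //.
    + by congr (_, _) => /=; rewrite ?bb ?mul0r // -mulrA cosupport_mul0 mulr0.
    + case=> _ /ffunP aa0; apply: a_or; apply/ffunP=> i; apply/eqP.
      by have /eqP := aa0 i; rewrite !ffunE mulf_eq0 orbb.
    + by case=> /eqP; rewrite oner_eq0.
  (* A common neighbour [(x, y)] has [y = 0] by [cosupport_ann], and the component 1 gives
     [x ^+ p = 0], so its [p]-th power vanishes. *)
  case=> -[x y] [[_ [k [l [_ _ e1 _ _]]]] [_ [p [q [p0 _ e2 w2 _]]]]].
  move: e1 e2 w2; rewrite !pair_expE /= => -[_ e1] [xp e2] w2.
  apply: w2; rewrite (cosupport_ann e1 e2) -[x ^+ p]mulr1 -(expr1n B q) xp.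
  by congr (_, _); apply/ffunP => i; rewrite dffun_expE !ffunE expr0n gtn_eqF.
(* If [cosupport a] were 0, every [a i] would be nonzero: absurd when [a = 0], and for invertible
   [b] it would force [w = 0]. *)
- have cs0 : cosupport a <> 0.
    move/ffunP => cs; case: bE => [[b' bb']|[_ a0]].
      have c0 : c = 0 by apply: (inv_exp_mul0 (n := 1) bb'); rewrite expr1.
      apply: w0; rewrite c0; congr (_, _); apply/ffunP => i.
      move/ffunP/(_ i): ad0; have := cs i; rewrite !ffunE.
      case: eqP => [_ /eqP|/eqP ai _ /eqP]; first by rewrite oner_eq0.
      by rewrite mulf_eq0 (negbTE ai) => /eqP.
    by have /eqP := cs (Ordinal n_gt0); rewrite a0 !ffunE eqxx oner_eq0.
  exists (0, cosupport a); split.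
    apply: ext_adj_mul0 => //; first by case=> _; exact: cosupport_neq.
      by case.
    by congr (_, _); rewrite /= ?mulr0 // cosupport_mul0.
  (* Again [y = 0]. An invertible [b] gives [x ^+ k = 0]. For the vertex [(eps, 0)], [x] is neither
     0 nor [eps], hence invertible, and the [l]-th power of the vertex vanishes. *)
  case=> -[x y] [[wv [k [l [k0 l0 e1 w1 v1]]]] [_ [p [q [p0 _ e2 w2 _]]]]].
  move: e1 e2 w1 w2 v1; rewrite !pair_expE /= => -[xb e1] [_ e2].
  have y0 := cosupport_ann e1 e2; move: wv; rewrite y0 => wv.
  have zX m : (0 < m)%N -> (0 : P) ^+ m = 0.
    by move=> m0; apply/ffunP => i; rewrite dffun_expE !ffunE expr0n gtn_eqF.
  rewrite !zX // => w1 w2 v1; case: bE => [[b' bb']|[be a0]].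
    apply: w1; congr (_, _); apply: (inv_exp_mul0 bb').
    by rewrite mulrC; exact: xb.
  have xe : x <> eps by move=> xe; apply: wv; rewrite xe be a0.
  have x0 : x <> 0.
    by move=> x0; apply: w1; rewrite x0 expr0n gtn_eqF.
  have [x' xx'] := dual_gen_inv x0 xe.
  apply: v1; rewrite a0 zX //; congr (_, _).
  exact: (inv_exp_mul0 xx' xb).
Qed.

End Converse.

Theorem theorem2p6 (R : finComNzRingType)
    (hR : ~ same_graph (zd_graph R) (ext_zd_graph R)) :
  complemented (ext_zd_graph R) <->
  exists (n : nat) (B : comNzRingType) (A : 'I_n -> finFieldType),
    [/\ (1 <= n)%N,
        ring_iso B 'Z_4 \/ ring_iso B Z2X_modX2
      & ring_iso R (B * {dffun forall i : 'I_n, A i})%type].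
Proof.
split=> [compl|[n [B [A [n_gt0 /dual_genP[eps gen] [f [g fK gK]]]]]]].
  have [a [a0 aa nil [f [ff f0 f1]]]] := nilradical_pair hR compl.
  exact: nilradical_pair_decomposition nil ff f0 f1.
have injf := can_inj fK; apply/complementedP => x y x0 y0 xy0.
have f0 z : z <> 0 -> f z <> 0.
  by move=> z0 fz; apply: z0; apply: injf; rewrite fz rmorph0.
have fxy : f x * f y = 0 by rewrite -rmorphM xy0 rmorph0.
have [u [fxu nw]] := exists_ext_orth n_gt0 gen (f0 _ x0) (f0 _ y0) fxy.
exists (g u); split; first by apply/(ext_adj_rmorph _ _ injf); rewrite gK.
case=> w [wx wu]; apply: nw; exists (f w).
split; first exact/(ext_adj_rmorph _ _ injf).
by rewrite -(gK u); apply/(ext_adj_rmorph _ _ injf).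
Qed.
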